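(* Let $\mathcal G=(\mathcal V,\mathcal E)$ be a network topology, $x^0$ a vector of initial traffic volumes, $T>0$, and $\lambda_i(t)$, $t\ge 0$, exogenous inflows at the sources $i\in\mathcal R$. Then: (i) For any feasible solution $(x(t),y(t),z(t),\mu(t),f(t))$ of the relaxed DTA problem, set, for $t\in[0,T]$, $$\alpha_i(t)=\begin{cases} z_i(t)/d_i(x_i(t)) & i\in\mathcal E\setminus\mathcal R,\\ z_i(t)/C_i(t) & i\in\mathcal R,\end{cases}\qquad R_{ij}(t)=\begin{cases} f_{ij}(t)/z_i(t) & (i,j)\in\mathcal A,\\ 0 & (i,j)\in(\mathcal E\times\mathcal E)\setminus\mathcal A,\end{cases}$$ with the conventions that $\alpha_i(t)=1$ if $z_i(t)=d_i(x_i(t))=0$ on a non-source cell $i$, that $\alpha_i(t)=1$ if $C_i(t)=0$ on a source cell $i$, and that, if $z_i(t)=0$, then $R_{ij}(t)=|\{k\in\mathcal E:(i,k)\in\mathcal A\}|^{-1}$ for all $(i,j)\in\mathcal A$. Then $R(t)$ satisfies the routing constraints (R1)-(R2), and $x(t)$ (with $y,z,\mu,f$) satisfies the controlled dynamics (T1)-(T3) with these $\alpha(t)$ and $R(t)$, so that $(\alpha(t),R(t))$ is a feasible solution of the DTA problem. (ii) Let $R(t)$, $t\in[0,T]$, be an exogenous routing matrix satisfying (R1)-(R2). For any feasible solution $(x(t),y(t),z(t),\mu(t),f(t))$ of the relaxed FNC problem, set $\alpha(t)$, $t\in[0,T]$, by the same formula (and conventions) as in (i). Then $x(t)$ (with $y,z,\mu,f$)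 satisfies the controlled dynamics (T1)-(T3) with this $\alpha(t)$ and the given $R(t)$, so that $\alpha(t)$ is a feasible solution of the FNC problem. Furthermore, in both cases (i) and (ii), the implemented trajectory is always in free-flow, i.e., $z_i(t)=\overline d_i(x_i(t),\alpha_i(t))$ for all $t\in[0,T]$ and all $i\in\mathcal E$.
   Context: **Network.** $\mathcal G=(\mathcal V,\mathcal E)$ is a finite directed multigraph whose links $i\in\mathcal E$ are called cells; cell $i$ is directed from $\sigma_i\in\mathcal V$ to $\tau_i\in\mathcal V$. A distinguished node $w\in\mathcal V$ represents the external world. $\mathcal R=\{i\in\mathcal E:\sigma_i=w\}$ is the set of sources, $\mathcal S=\{i\in\mathcal E:\tau_i=w\}$ the set of sinks, and $\mathcal A=\{(i,j)\in\mathcal E\times\mathcal E:\tau_i=\sigma_j\neq w\}$ the set of adjacent pairs of cells. Every non-sink cell $i$ has at least one $j$ with $(i,j)\in\mathcal A$. Flows $f_{ij}$ are indexed by $(i,j)\in\mathcal A$, with $f_{ij}=0$ for $(i,j)\notin\mathcal A$. **Cells.** For each $i\in\mathcal E$: $d_i:[0,\infty)\to[0,\infty)$ is continuous, non-decreasing, concave, with $d_i(0)=0$; $C_i=C_i(t)\ge 0$ is the (possibly time-varying) flow capacity. For $i\in\mathcal E\setminus\mathcal R$ the supply function $s_i:[0,\infty)\to\mathbb R$ is continuous, non-increasing, concave, with $s_i(0)>0$; for $i\in\mathcal R$, $s_i\equiv+\infty$. The controlled demand functions, with demand control parameter $\alpha_i=\alpha_i(t)\in[0,1]$, are $$\overline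 d_i(x_i,\alpha_i)=\min\{\alpha_i d_i(x_i),C_i\}\ (i\in\mathcal E\setminus\mathcal R),\qquad \overline d_i(x_i,\alpha_i)=\min\{d_i(x_i),\alpha_iC_i\}\ (i\in\mathcal R).$$ **Inflows and initial volumes.** $\lambda_i(t)\ge 0$ for $i\in\mathcal R$, $\lambda_i\equiv 0$ for $i\notin\mathcal R$; $x^0_i\ge 0$ for all $i$. **Mass conservation.** (M) For all $i\in\mathcal E$: $\dot x_i=y_i-z_i$, $y_i=\lambda_i+\sum_{j\in\mathcal E}f_{ji}$, $z_i=\mu_i+\sum_{j\in\mathcal E}f_{ij}$, and $x_i(0)=x_i^0$. Here $x$ is absolutely continuous and the differential equation holds for almost every $t$; the other constraints hold for all $t\in[0,T]$. The outflows $\mu_i$ vanish for $i\in\mathcal E\setminus\mathcal S$. **Routing constraints.** $R=R(t)$ is a nonnegative $\mathcal E\times\mathcal E$ matrix with (R1) $R_{ij}=0$ for $(i,j)\notin\mathcal A$; (R2) $\sum_{j\in\mathcal E}R_{ij}=1$ for $i\in\mathcal E\setminus\mathcal S$. **Controlled traffic dynamics.** (T1) $z_k=\mu_k=\overline d_k(x_k,\alpha_k)$ for $k\in\mathcal S$; (T2) $f_{ij}=R_{ij}z_i$ and $z_i=\gamma_i^F\,\overline d_i(x_i,\alpha_i)$ for $(i,j)\in\mathcal A$; (T3) for $i\in\mathcal E$, $$\gamma_i^F=\sup\Big\{\gamma\in[0,1]:\ \gamma\sum_{h\in\mathcal E}R_{hk}\overline d_h(x_h,\alpha_h)\le s_k(x_k)\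 \text{ for all }k\in\mathcal E\text{ with }(i,k)\in\mathcal A\Big\}.$$ **Problems.** Let $\psi(x,z)$ be a running cost that is convex in $(x,z)$, non-decreasing in each $x_i$, non-increasing in each $z_i$, with $\psi(0,0)=0$. All problems minimize $\int_0^T\psi(x(t),z(t))\,dt$. - DTA problem: minimize over $\alpha(t)\in[0,1]^{\mathcal E}$ and $R(t)$ subject to (M), (R1)-(R2), (T1)-(T3). - FNC problem: $R(t)$ satisfying (R1)-(R2) is given; minimize over $\alpha(t)\in[0,1]^{\mathcal E}$ subject to (M), (T1)-(T3). - Relaxed DTA problem: minimize over $(x,y,z,f,\mu)$ subject to (M), $f_{ij}\ge 0$ for $(i,j)\in\mathcal A$, $\mu_i\ge 0$ for $i\in\mathcal S$, $\mu_i=0$ for $i\in\mathcal E\setminus\mathcal S$, and $y_i\le s_i(x_i)$, $z_i\le\min\{d_i(x_i),C_i\}$ for $i\in\mathcal E$. - Relaxed FNC problem: the relaxed DTA problem with the additional constraint $f_{ij}(t)=R_{ij}(t)z_i(t)$ for $(i,j)\in\mathcal A$, where $R(t)$ satisfying (R1)-(R2) is given. ''Feasible solution'' means a point satisfying the constraints of the respective problem. *)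

(* Defs.v *)
From HB Require Import structures.
From mathcomp Require Import all_boot all_order all_algebra.
From mathcomp Require Import all_classical all_reals all_analysis.

Set Implicit Arguments.
Unset Strict Implicit.
Unset Printing Implicit Defensive.

Import Order.TTheory GRing.Theory Num.Theory.
Import numFieldNormedType.Exports.

Local Open Scope classical_set_scope.
Local Open Scope ring_scope.

(* Finite directed multigraph: cells are the links, [world] is the external
   node, a cell goes from its [tail] to its [head]. *)
Record network := Network {
  node : finType;
  cell : finType;
  tail : cell -> node;
  head : cell -> node;
  world : node;
  non_sink_has_next : forall i : cell, head i != world ->
    exists j : cell, (head i == tail j) && (head i != world)
}.

Definition sources (G : network) : {set cell G} :=
  [set i : cell G | tail i == world G]%SET.

Definition sinks (G : network) : {set cell G} :=
  [set i : cell G | head i == world G]%SET.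

Definition adjacent_cells (G : network) (i j : cell G) : bool :=
  (head i == tail j) && (head i != world G).

Definition concave_on (R : realType) (A : set R) (g : R -> R) : Prop :=
  convex_function (A : set R^o) (fun v => - g v).

(* The functions of the volume live on [0, +oo[: they are total here, their
   values on negative volumes are unconstrained and never used.  The field
   [supply_fun] is meaningful only on non-source cells, see [supply]. *)
Record cell_data (R : realType) (G : network) := CellData {
  demand : cell G -> R -> R;
  supply_fun : cell G -> R -> R;
  capacity : R -> cell G -> R;
  demand_ge0 : forall i v, 0 <= v -> 0 <= demand i v;
  demand_continuous : forall i, {within `[0, +oo[, continuous (demand i)};
  demand_nondecreasing : forall i,
    {in `[0, +oo[ &, {homo demand i : u v / u <= v}};
  demand_concave : forall i, concave_on `[0, +oo[ (demand i);
  demand0 : forall i, demand i 0 = 0;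
  supply_continuous : forall i, i \notin sources G ->
    {within `[0, +oo[, continuous (supply_fun i)};
  supply_nonincreasing : forall i, i \notin sources G ->
    {in `[0, +oo[ &, {homo supply_fun i : u v /~ u <= v}};
  supply_concave : forall i, i \notin sources G ->
    concave_on `[0, +oo[ (supply_fun i);
  supply0_gt0 : forall i, i \notin sources G -> 0 < supply_fun i 0;
  capacity_ge0 : forall (t : R) (i : cell G), 0 <= t -> 0 <= capacity t i
}.

Definition supply (R : realType) (G : network) (D : cell_data R G)
    (i : cell G) (v : R) : \bar R :=
  if i \in sources G then +oo%E else (supply_fun D i v)%:E.

Definition controlled_demand (R : realType) (G : network) (D : cell_data R G)
    (t : R) (i : cell G) (v a : R) : R :=
  if i \in sources G then Num.min (demand D i v) (a * capacity D t i)
  else Num.min (a * demand D i v) (capacity D t i).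

Definition inflow_profile (R : realType) (G : network)
    (lambda : R -> cell G -> R) : Prop :=
  (forall (t : R) (i : cell G), 0 <= t -> i \in sources G -> 0 <= lambda t i) /\
  (forall (t : R) (i : cell G), 0 <= t -> i \notin sources G -> lambda t i = 0).

(* Time functions are total on R; only their values on [0, T] matter. *)
Record trajectory (R : realType) (G : network) := Trajectory {
  vol : R -> cell G -> R;                   (* x *)
  inflow : R -> cell G -> R;                (* y *)
  outflow : R -> cell G -> R;               (* z *)
  ext_outflow : R -> cell G -> R;           (* mu *)
  flow : R -> cell G -> cell G -> R         (* f *)
}.

Definition absolutely_continuous_on (R : realType) (a b : R) (g : R -> R)
    : Prop :=
  forall e : R, 0 < e -> exists2 d : R, 0 < d &
    forall (n : nat) (u v : 'I_n -> R),
      (forall k, a <= u k /\ u k <= v k /\ v k <= b) ->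
      trivIset setT (fun k => `]u k, v k[%classic) ->
      \sum_(k < n) (v k - u k) < d ->
      \sum_(k < n) `|g (v k) - g (u k)| < e.

(* Volumes are required to stay in [0, +oo[, the domain of the demand and
   supply functions. *)
Definition mass_conservation (R : realType) (G : network) (T : R)
    (x0 : cell G -> R) (lambda : R -> cell G -> R) (p : trajectory R G)
    : Prop :=
  (forall i, absolutely_continuous_on 0 T (fun t => vol p t i)) /\
  (forall i, {ae @lebesgue_measure R, forall t : R, 0 < t < T ->
     is_derive t 1 (fun u : R => vol p u i) (inflow p t i - outflow p t i)}) /\
  (forall i, vol p 0 i = x0 i) /\
  (forall t : R, 0 <= t <= T ->
     (forall i, 0 <= vol p t i) /\
     (forall i, inflow p t i = lambda t i + \sum_(j : cell G) flow p t j i) /\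
     (forall i,
        outflow p t i = ext_outflow p t i + \sum_(j : cell G) flow p t i j) /\
     (forall i j, ~~ adjacent_cells i j -> flow p t i j = 0) /\
     (forall i, i \notin sinks G -> ext_outflow p t i = 0)).

Definition routing_constraints (R : realType) (G : network) (T : R)
    (rt : R -> cell G -> cell G -> R) : Prop :=
  forall t : R, 0 <= t <= T ->
    (forall i j, 0 <= rt t i j) /\
    (forall i j, ~~ adjacent_cells i j -> rt t i j = 0) /\
    (forall i, i \notin sinks G -> \sum_(j : cell G) rt t i j = 1).

(* The convention is sup set0 = 0, which is the supremum of the empty set
   within [0, 1]; it is relevant only when some supply is negative. *)
Definition flow_factor (R : realType) (G : network) (D : cell_data R G)
    (t : R) (x alpha : cell G -> R) (r : cell G -> cell G -> R) (i : cell G)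
    : R :=
  sup [set g : R | 0 <= g <= 1 /\
    forall k : cell G, adjacent_cells i k ->
      ((g * \sum_(h : cell G) r h k * controlled_demand D t h (x h) (alpha h))%:E
         <= supply D k (x k))%E].

Definition controlled_dynamics (R : realType) (G : network)
    (D : cell_data R G) (T : R) (alpha : R -> cell G -> R)
    (rt : R -> cell G -> cell G -> R) (p : trajectory R G) : Prop :=
  forall t : R, 0 <= t <= T ->
    (forall k, k \in sinks G ->
       outflow p t k = ext_outflow p t k /\
       ext_outflow p t k = controlled_demand D t k (vol p t k) (alpha t k)) /\
    (forall i j, adjacent_cells i j ->
       flow p t i j = rt t i j * outflow p t i /\
       outflow p t i = flow_factor D t (vol p t) (alpha t) (rt t) i
                       * controlled_demand D t i (vol p t i) (alpha t i)).

Definition admissible_control (R : realType) (G : network) (T : R)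
    (alpha : R -> cell G -> R) : Prop :=
  forall (t : R) (i : cell G), 0 <= t <= T -> 0 <= alpha t i <= 1.

Definition DTA_constraints (R : realType) (G : network) (D : cell_data R G)
    (T : R) (x0 : cell G -> R) (lambda : R -> cell G -> R)
    (alpha : R -> cell G -> R) (rt : R -> cell G -> cell G -> R)
    (p : trajectory R G) : Prop :=
  admissible_control T alpha /\
  mass_conservation T x0 lambda p /\
  routing_constraints T rt /\
  controlled_dynamics D T alpha rt p.

Definition DTA_feasible (R : realType) (G : network) (D : cell_data R G)
    (T : R) (x0 : cell G -> R) (lambda : R -> cell G -> R)
    (alpha : R -> cell G -> R) (rt : R -> cell G -> cell G -> R) : Prop :=
  exists p : trajectory R G, DTA_constraints D T x0 lambda alpha rt p.

Definition FNC_constraints (R : realType) (G : network) (D : cell_data R G)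
    (T : R) (x0 : cell G -> R) (lambda : R -> cell G -> R)
    (rt : R -> cell G -> cell G -> R) (alpha : R -> cell G -> R)
    (p : trajectory R G) : Prop :=
  admissible_control T alpha /\
  mass_conservation T x0 lambda p /\
  controlled_dynamics D T alpha rt p.

Definition FNC_feasible (R : realType) (G : network) (D : cell_data R G)
    (T : R) (x0 : cell G -> R) (lambda : R -> cell G -> R)
    (rt : R -> cell G -> cell G -> R) (alpha : R -> cell G -> R) : Prop :=
  exists p : trajectory R G, FNC_constraints D T x0 lambda rt alpha p.

Definition relaxed_DTA_feasible (R : realType) (G : network)
    (D : cell_data R G) (T : R) (x0 : cell G -> R)
    (lambda : R -> cell G -> R) (p : trajectory R G) : Prop :=
  mass_conservation T x0 lambda p /\
  (forall t : R, 0 <= t <= T ->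
     (forall i j, adjacent_cells i j -> 0 <= flow p t i j) /\
     (forall i, i \in sinks G -> 0 <= ext_outflow p t i) /\
     (forall i, i \notin sinks G -> ext_outflow p t i = 0) /\
     (forall i, ((inflow p t i)%:E <= supply D i (vol p t i))%E) /\
     (forall i, outflow p t i
                <= Num.min (demand D i (vol p t i)) (capacity D t i))).

Definition relaxed_FNC_feasible (R : realType) (G : network)
    (D : cell_data R G) (T : R) (x0 : cell G -> R)
    (lambda : R -> cell G -> R) (rt : R -> cell G -> cell G -> R)
    (p : trajectory R G) : Prop :=
  relaxed_DTA_feasible D T x0 lambda p /\
  (forall t : R, 0 <= t <= T -> forall i j, adjacent_cells i j ->
     flow p t i j = rt t i j * outflow p t i).

Definition induced_control (R : realType) (G : network) (D : cell_data R G)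
    (p : trajectory R G) (t : R) (i : cell G) : R :=
  if i \in sources G then
    if capacity D t i == 0 then 1 else outflow p t i / capacity D t i
  else if (outflow p t i == 0) && (demand D i (vol p t i) == 0) then 1
  else outflow p t i / demand D i (vol p t i).

Definition induced_routing (R : realType) (G : network) (p : trajectory R G)
    (t : R) (i j : cell G) : R :=
  if adjacent_cells i j then
    if outflow p t i == 0 then (#|[set k | adjacent_cells i k]%SET|%:R)^-1
    else flow p t i j / outflow p t i
  else 0.

Definition in_free_flow (R : realType) (G : network) (D : cell_data R G)
    (T : R) (alpha : R -> cell G -> R) (p : trajectory R G) : Prop :=
  forall (t : R) (i : cell G), 0 <= t <= T ->
    outflow p t i = controlled_demand D t i (vol p t i) (alpha t i).

(* Main.v *)
Require Import Defs.
From mathcomp Require Import all_boot all_order all_algebra.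
From mathcomp Require Import all_classical all_reals all_analysis.

(** Why the statement holds.  Apart from mass conservation, which is
    shared by both problems, everything happens at one fixed time.  In a
    relaxed solution every outflow satisfies [0 <= z_i <= min (d_i x_i, C_i)],
    and the induced control is chosen so that the controlled demand becomes
    exactly [z_i]: the bound on [z_i] makes the other argument of the minimum
    inactive, and forces [z_i = 0] in the degenerate cases of a zero
    denominator ([controlled_demand_induced]).

    Suppose moreover that the flows are split according to a routing matrix,
    [f_ij = R_ij z_i].  Then the demand directed towards a cell [k] is
    [\sum_h R_hk z_h = \sum_h f_hk = y_k - lambda_k <= y_k <= s_k x_k], so the
    value [g = 1] is admissible in the supremum that defines the flow factor;
    hence all the flow factors are 1 and the dynamics are in free flow
    ([flow_factor_induced], [controlled_dynamics_induced]).  For the relaxed FNC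
    problem the splitting of the flows is a constraint.  For the relaxed DTA
    problem it holds for the induced routing matrix, whose rows sum to 1 by
    conservation of the outflow ([flow_induced_routing],
    [routing_constraints_induced]). *)

Set Implicit Arguments.
Unset Strict Implicit.
Unset Printing Implicit Defensive.

Import Order.TTheory GRing.Theory Num.Theory.

Local Open Scope ring_scope.

Lemma sinks_not_adjacent (G : network) (i j : cell G) :
  i \in sinks G -> ~~ adjacent_cells i j.
Proof. by rewrite inE /adjacent_cells => /eqP ->; rewrite eqxx andbF. Qed.

Lemma card_adjacent_gt0 (G : network) (i : cell G) :
  i \notin sinks G -> (0 < #|[set k | adjacent_cells i k]%SET|)%N.
Proof.
rewrite inE => /non_sink_has_next[j ij].
by apply/card_gt0P; exists j; rewrite inE.
Qed.

Section RelaxedSolution.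
Context {R : realType} {G : network} (D : cell_data R G) (T : R).
Context (x0 : cell G -> R) (lambda : R -> cell G -> R) (p : trajectory R G).
Hypothesis lambdaP : inflow_profile lambda.
Hypothesis pP : relaxed_DTA_feasible D T x0 lambda p.

Let alpha := induced_control D p.

Lemma relaxed_inflowE t i : 0 <= t <= T ->
  inflow p t i = lambda t i + \sum_(j : cell G) flow p t j i.
Proof. by case: pP => -[_ [_ [_ +]]] _ tT => /(_ t tT)[_ []]. Qed.

Lemma relaxed_outflowE t i : 0 <= t <= T ->
  outflow p t i = ext_outflow p t i + \sum_(j : cell G) flow p t i j.
Proof. by case: pP => -[_ [_ [_ +]]] _ tT => /(_ t tT)[_ [_ []]]. Qed.

Lemma relaxed_flow_eq0 t i j : 0 <= t <= T ->
  ~~ adjacent_cells i j -> flow p t i j = 0.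
Proof.
by case: pP => -[_ [_ [_ +]]] _ tT => /(_ t tT)[_ [_ [_ []]]] + _; apply.
Qed.

Lemma relaxed_flow_ge0 t i j : 0 <= t <= T -> 0 <= flow p t i j.
Proof.
move=> tT; have [ij|/relaxed_flow_eq0 ->//] := boolP (adjacent_cells i j).
by case: pP => _ /(_ t tT)[+ _]; apply.
Qed.

Lemma relaxed_ext_outflow_eq0 t i : 0 <= t <= T ->
  i \notin sinks G -> ext_outflow p t i = 0.
Proof. by case: pP => _ + tT => /(_ t tT)[_ [_ [+ _]]]; apply. Qed.

Lemma relaxed_ext_outflow_ge0 t i : 0 <= t <= T -> 0 <= ext_outflow p t i.
Proof.
move=> tT; have [iS|/relaxed_ext_outflow_eq0 ->//] := boolP (i \in sinks G).
by case: pP => _ /(_ t tT)[_ [+ _]]; apply.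
Qed.

Lemma relaxed_inflow_le_supply t i : 0 <= t <= T ->
  ((inflow p t i)%:E <= supply D i (vol p t i))%E.
Proof. by case: pP => _ + tT => /(_ t tT)[_ [_ [_ [+ _]]]]; apply. Qed.

Lemma relaxed_outflow_le t i : 0 <= t <= T ->
  outflow p t i <= demand D i (vol p t i) /\ outflow p t i <= capacity D t i.
Proof.
case: pP => _ + tT => /(_ t tT)[_ [_ [_ [_ /(_ i)]]]].
by rewrite le_min => /andP.
Qed.

Lemma relaxed_outflow_ge0 t i : 0 <= t <= T -> 0 <= outflow p t i.
Proof.
move=> tT; rewrite relaxed_outflowE// addr_ge0 ?relaxed_ext_outflow_ge0//.
by apply: sumr_ge0 => j _; exact: relaxed_flow_ge0.
Qed.

Lemma relaxed_flow_le_outflow t i j : 0 <= t <= T ->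
  flow p t i j <= outflow p t i.
Proof.
move=> tT; rewrite relaxed_outflowE// (bigD1 j)//= addrCA lerDl.
rewrite addr_ge0 ?relaxed_ext_outflow_ge0//.
by apply: sumr_ge0 => k _; exact: relaxed_flow_ge0.
Qed.

Lemma outflow_sink t i : 0 <= t <= T ->
  i \in sinks G -> outflow p t i = ext_outflow p t i.
Proof.
move=> tT iS; rewrite relaxed_outflowE// big1 ?addr0// => j _.
exact/relaxed_flow_eq0/sinks_not_adjacent.
Qed.

Lemma outflow_non_sink t i : 0 <= t <= T ->
  i \notin sinks G -> outflow p t i = \sum_(j : cell G) flow p t i j.
Proof.
by move=> tT iS; rewrite relaxed_outflowE// relaxed_ext_outflow_eq0// add0r.
Qed.

(** The induced control makes the controlled demand equal to the outflow. *)
Lemma controlled_demand_induced t i : 0 <= t <= T ->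
  controlled_demand D t i (vol p t i) (alpha t i) = outflow p t i.
Proof.
move=> tT; have [zd zC] := relaxed_outflow_le i tT.
have z0 := relaxed_outflow_ge0 i tT.
rewrite /controlled_demand /alpha /induced_control.
have [iR|iR] := boolP (i \in sources G).
  have [C0|C0] := eqVneq (capacity D t i) 0; last by rewrite divfK// min_r.
  have zE : outflow p t i = 0 by apply/le_anti; rewrite z0 -C0 zC.
  by rewrite C0 mulr0 zE min_r// -zE.
have [d0|d0] := eqVneq (demand D i (vol p t i)) 0.
  have zE : outflow p t i = 0 by apply/le_anti; rewrite z0 -d0 zd.
  by rewrite d0 mulr0 zE min_l// -zE.
by rewrite andbF divfK// min_l.
Qed.

Lemma admissible_control_induced : admissible_control T alpha.
Proof.
move=> t i tT; have [zd zC] := relaxed_outflow_le i tT.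
have z0 := relaxed_outflow_ge0 i tT.
have C0 := le_trans z0 zC; have d0 := le_trans z0 zd.
rewrite /alpha /induced_control.
case: ifP => _; case: ifPn => [_|nz]; rewrite ?ler01 ?lexx// divr_ge0//=.
  by rewrite ler_pdivrMr ?mul1r// lt_neqAle eq_sym nz.
have [dE|dN] := eqVneq (demand D i (vol p t i)) 0.
  by rewrite dE invr0 mulr0 ler01.
by rewrite ler_pdivrMr ?mul1r// lt_neqAle eq_sym dN.
Qed.

Lemma in_free_flow_induced : in_free_flow D T alpha p.
Proof. by move=> t i tT; rewrite controlled_demand_induced. Qed.

(** Any routing matrix supported on the adjacent pairs that splits the flows of
    [p]; this covers both the induced and a prescribed routing. *)
Section SplitFlows.
Variable rt : R -> cell G -> cell G -> R.
Hypothesis rt0 : forall t i j, 0 <= t <= T ->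
  ~~ adjacent_cells i j -> rt t i j = 0.
Hypothesis flowE : forall t i j, 0 <= t <= T ->
  adjacent_cells i j -> flow p t i j = rt t i j * outflow p t i.

(** The demand directed towards a cell is its inflow from other cells, which
    the supply constraint bounds. *)
Lemma routed_demand_le_supply t k : 0 <= t <= T ->
  ((\sum_(h : cell G)
      rt t h k * controlled_demand D t h (vol p t h) (alpha t h))%:E
    <= supply D k (vol p t k))%E.
Proof.
move=> tT; apply: le_trans (relaxed_inflow_le_supply k tT).
rewrite lee_fin relaxed_inflowE//.
under eq_bigr => h _.
  rewrite controlled_demand_induced//.
  have -> : rt t h k * outflow p t h = flow p t h k.
    have [hk|hk] := boolP (adjacent_cells h k); first by rewrite flowE.
    by rewrite rt0// mul0r relaxed_flow_eq0.
  over.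
rewrite lerDr; case: lambdaP => lambda_ge0 lambda0.
have /andP[t0 _] := tT.
have [kR|kR] := boolP (k \in sources G); first exact: lambda_ge0.
by rewrite lambda0.
Qed.

(** The supply constraints already hold with the factor 1. *)
Lemma flow_factor_induced t i : 0 <= t <= T ->
  flow_factor D t (vol p t) (alpha t) (rt t) i = 1.
Proof.
move=> tT; rewrite /flow_factor; set S := (X in sup X).
have S1 : S 1.
  split=> [|k _]; first by rewrite ler01 lexx.
  by rewrite mul1r; exact: routed_demand_le_supply.
have ubS : ubound S 1 by move=> g [/andP[]].
apply/le_anti/andP; split; first by apply: ge_sup => //; exists 1.
by apply: ub_le_sup => //; exists 1.
Qed.

Lemma controlled_dynamics_induced : controlled_dynamics D T alpha rt p.
Proof.
move=> t tT; split=> [k kS|i j ij].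
  by rewrite controlled_demand_induced// outflow_sink.
by rewrite flowE// flow_factor_induced// mul1r controlled_demand_induced.
Qed.

End SplitFlows.

Lemma induced_routing_eq0 t i j :
  ~~ adjacent_cells i j -> induced_routing p t i j = 0.
Proof. by rewrite /induced_routing => /negbTE ->. Qed.

(** If the outflow vanishes then so do all the flows out of the cell, hence the
    uniform split chosen there is compatible with them. *)
Lemma flow_induced_routing t i j : 0 <= t <= T ->
  adjacent_cells i j ->
  flow p t i j = induced_routing p t i j * outflow p t i.
Proof.
move=> tT ij; rewrite /induced_routing ij.
have [z0|z0] := eqVneq (outflow p t i) 0; last by rewrite divfK.
apply/le_anti; rewrite z0 mulr0 relaxed_flow_ge0// andbT -z0.
exact: relaxed_flow_le_outflow.
Qed.

Lemma routing_constraints_induced : routing_constraints T (induced_routing p).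
Proof.
move=> t tT; split=> [i j|].
  rewrite /induced_routing; case: ifP => // _; case: ifP => _.
    by rewrite invr_ge0.
  by rewrite divr_ge0 ?relaxed_flow_ge0 ?relaxed_outflow_ge0.
split=> [i j|i iS]; first exact: induced_routing_eq0.
have [z0|z0] := eqVneq (outflow p t i) 0.
  (* The uniform split over the cells adjacent to [i]. *)
  rewrite (bigID (adjacent_cells i))/= [X in _ + X]big1 ?addr0; last first.
    by move=> j; exact: induced_routing_eq0.
  under eq_bigr => j ij do rewrite /induced_routing ij z0 eqxx.
  rewrite sumr_const -[LHS]mulr_natr cardsE mulVf// pnatr_eq0 -lt0n.
  by rewrite -cardsE; exact: card_adjacent_gt0.
(* Multiplied by the outflow, the row sum is the sum of the flows out of [i]. *)
apply: (mulIf z0); rewrite mul1r mulr_suml outflow_non_sink//.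
apply: eq_bigr => j _; rewrite -outflow_non_sink//.
have [ij|ij] := boolP (adjacent_cells i j); last first.
  by rewrite induced_routing_eq0// mul0r relaxed_flow_eq0.
by rewrite flow_induced_routing.
Qed.

End RelaxedSolution.

Unset Implicit Arguments.

Theorem proposition1 (R : realType) (G : network) (D : cell_data R G)
    (T : R) (x0 : cell G -> R) (lambda : R -> cell G -> R)
    (T_gt0 : 0 < T) (x0_ge0 : forall i : cell G, 0 <= x0 i)
    (lambdaP : inflow_profile lambda) :
  (forall p : trajectory R G,
     relaxed_DTA_feasible D T x0 lambda p ->
     let alpha := induced_control D p in
     let rt := induced_routing p in
     routing_constraints T rt /\
     controlled_dynamics D T alpha rt p /\
     DTA_constraints D T x0 lambda alpha rt p /\
     DTA_feasible D T x0 lambda alpha rt /\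
     in_free_flow D T alpha p)
  /\
  (forall rt : R -> cell G -> cell G -> R,
     routing_constraints T rt ->
     forall p : trajectory R G,
     relaxed_FNC_feasible D T x0 lambda rt p ->
     let alpha := induced_control D p in
     controlled_dynamics D T alpha rt p /\
     FNC_constraints D T x0 lambda rt alpha p /\
     FNC_feasible D T x0 lambda rt alpha /\
     in_free_flow D T alpha p).
Proof.
split=> [p pP alpha rt|rt rtP p [pP flowE] alpha].
  have rtP : routing_constraints T rt := routing_constraints_induced pP.
  have dyn : controlled_dynamics D T alpha rt p.
    apply: (controlled_dynamics_induced lambdaP pP) => t i j tT.
      exact: induced_routing_eq0.
    exact: (flow_induced_routing pP).
  have DTA : DTA_constraints D T x0 lambda alpha rt p.
    by split; [exact: (admissible_control_induced pP) | case: pP].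
  do 3![split=> //]; split; first by exists p.
  exact: (in_free_flow_induced pP).
have dyn : controlled_dynamics D T alpha rt p.
  apply: (controlled_dynamics_induced lambdaP pP) => t i j tT.
    by case: (rtP t tT) => _ [+ _]; apply.
  exact: flowE.
have FNC : FNC_constraints D T x0 lambda rt alpha p.
  by split; [exact: (admissible_control_induced pP) | case: pP].
do 2![split=> //]; split; first by exists p.
exact: (in_free_flow_induced pP).
Qed.
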